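(* Let $G$ be a finite simple graph. If $X \subseteq V(G)$ can be expressed as a union of one or more inclusion minimal sets with positive difference, then (i) $X$ is an independent set of $G$; (ii) $d(X)>0$; (iii) $d(Y)<d(X)$ for every proper subset $Y\subsetneq X$.
   Context: For $A \subseteq V(G)$, $N(A)$ is the set of vertices adjacent to some vertex of $A$, and $d(A)=|A|-|N(A)|$. A set $S \subseteq V(G)$ is an inclusion minimal set with positive difference if $d(S)>0$ and no proper subset of $S$ has positive difference. *)

(* Defs.v *)
From mathcomp Require Import all_boot all_order all_algebra.

Set Implicit Arguments.
Unset Strict Implicit.
Unset Printing Implicit Defensive.

Import Order.TTheory GRing.Theory Num.Theory.
Local Open Scope ring_scope.

(* Here [e] is the adjacency relation of a graph with vertex type [V].
   The neighbourhood is open: it may or may not meet [A]. *)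
Definition neighbours (V : finType) (e : rel V) (A : {set V}) : {set V} :=
  [set v | [exists u in A, e u v]].

Definition difference (V : finType) (e : rel V) (A : {set V}) : int :=
  #|A|%:Z - #|neighbours e A|%:Z.

Definition independent (V : finType) (e : rel V) (A : {set V}) : Prop :=
  {in A &, forall u v, ~~ e u v}.

Definition min_positive (V : finType) (e : rel V) (S : {set V}) : bool :=
  minset (fun A => 0 < difference e A) S.

Definition union_min_positive (V : finType) (e : rel V) (X : {set V}) : Prop :=
  exists P : {set {set V}},
    [/\ P != set0, (forall S, S \in P -> min_positive e S) & X = cover P].

(* Main.v *)
(** The difference function is supermodular, so adjoining to [Y] a minimal
    positive set [S] not contained in [Y] strictly increases the difference:
    the proper subset [Y :&: S] of [S] has nonpositive difference.  Enlarging
    [Y] in this way up to [X] gives (iii), and [Y = set0] gives (ii).  Removing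
    from [X] its vertices with a neighbour in [X] does not lower the difference,
    so by (iii) nothing is removed, which is (i). *)

Require Import Defs.
From mathcomp Require Import all_boot all_order all_algebra.
From mathcomp Require Import zify.

Import Order.TTheory GRing.Theory Num.Theory.
Local Open Scope ring_scope.

Lemma neighboursP (V : finType) (e : rel V) (A : {set V}) (v : V) :
  reflect (exists2 u, u \in A & e u v) (v \in neighbours e A).
Proof. by rewrite inE; apply: exists_inP. Qed.

Lemma neighboursS (V : finType) (e : rel V) (A B : {set V}) :
  A \subset B -> neighbours e A \subset neighbours e B.
Proof.
move=> /subsetP sAB; apply/subsetP=> v /neighboursP[u uA euv].
by apply/neighboursP; exists u => //; apply: sAB.
Qed.

Lemma neighboursU (V : finType) (e : rel V) (A B : {set V}) :
  neighbours e (A :|: B) = neighbours e A :|: neighbours e B.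
Proof.
apply/eqP; rewrite eqEsubset subUset !neighboursS ?subsetUl ?subsetUr // !andbT.
apply/subsetP=> v /neighboursP[u /setUP[] uAB euv]; apply/setUP; [left|right];
  by apply/neighboursP; exists u.
Qed.

Lemma difference0 (V : finType) (e : rel V) : difference e set0 = 0.
Proof.
rewrite /difference (_ : neighbours e set0 = set0) ?cards0 //.
by apply/setP=> v; rewrite in_set0; apply/neighboursP=> -[u]; rewrite in_set0.
Qed.

(** Cardinality is modular and [neighbours] commutes with unions, but it sends [A :&: B] only into
    the intersection of the two neighbourhoods. *)
Lemma difference_supermodular (V : finType) (e : rel V) (A B : {set V}) :
  difference e A + difference e B
    <= difference e (A :|: B) + difference e (A :&: B).
Proof.
have := subset_leq_card (_ : neighbours e (A :&: B)
          \subset neighbours e A :&: neighbours e B).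
rewrite subsetI !neighboursS ?subsetIl ?subsetIr // => /(_ isT).
have := cardsUI (neighbours e A) (neighbours e B).
have := cardsUI A B.
rewrite /difference neighboursU; lia.
Qed.

(** The vertices of [A :&: neighbours e A] leave [A], and by symmetry they also leave its
    neighbourhood, so the second term drops by at least as much as the first. *)
Lemma difference_setD_neighbours (V : finType) (e : rel V) (A : {set V}) :
  symmetric e -> difference e A <= difference e (A :\: neighbours e A).
Proof.
move=> e_sym.
have /subset_leq_card : neighbours e (A :\: neighbours e A)
    \subset neighbours e A :\: A.
  apply/subsetP=> v /neighboursP[u /setDP[uA uN] euv]; apply/setDP; split.
    by apply/neighboursP; exists u.
  by apply: contra uN => vA; apply/neighboursP; exists v; rewrite // e_sym.
have := cardsID (neighbours e A) A.
have := cardsID A (neighbours e A).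
rewrite setIC /difference; lia.
Qed.

Lemma min_positive_gt0 (V : finType) (e : rel V) (S : {set V}) :
  min_positive e S -> 0 < difference e S.
Proof. by case/minsetP. Qed.

Lemma difference_setU_min_positive (V : finType) (e : rel V) (S Y : {set V}) :
  min_positive e S -> ~~ (S \subset Y) ->
  difference e Y < difference e (Y :|: S).
Proof.
move=> /minsetP[dS minS] nSY.
have dYS : difference e (Y :&: S) <= 0.
  (* Were it positive, minimality would force [Y :&: S = S], hence [S \subset Y]. *)
  rewrite leNgt; apply: contra nSY => /minS /(_ (subsetIr _ _)) <-.
  exact: subsetIl.
have := difference_supermodular V e Y S; lia.
Qed.

(** Induction on the number of vertices of [cover P] outside [Y]: a missing vertex [x] lies in some
    [S] of [P], and [Y] is replaced by [Y :|: S]. *)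
Lemma difference_proper_cover (V : finType) (e : rel V) (P : {set {set V}})
    (Y : {set V}) :
  {in P, forall S, min_positive e S} -> Y \proper cover P ->
  difference e Y < difference e (cover P).
Proof.
move=> minP; have [n] := ubnP #|cover P :\: Y|.
elim: n Y => // n IHn Y leYn /properP[sYP [x /bigcupP[S SP xS] xY]].
have nSY : ~~ (S \subset Y) by apply: contra xY => /subsetP; apply.
have sSP : S \subset cover P by apply: bigcup_sup SP.
apply: lt_le_trans (difference_setU_min_positive _ _ _ _ (minP S SP) nSY) _.
have sYSP : Y :|: S \subset cover P by rewrite subUset sYP.
have [-> // | neYS] := eqVneq (Y :|: S) (cover P).
apply/ltW/IHn; last by rewrite properEneq neYS.
(* The measure drops because [x] is no longer missing. *)
rewrite -ltnS; apply: leq_trans leYn; rewrite ltnS; apply/proper_card/properP.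
split; first exact/setDS/subsetUl.
by exists x; rewrite !inE (negPf xY) ?xS // (subsetP sSP).
Qed.

Theorem theorem2p14 (V : finType) (e : rel V)
    (e_sym : symmetric e) (e_irr : irreflexive e)
    (X : {set V}) (hX : union_min_positive e X) :
  [/\ independent e X,
      0 < difference e X
    & forall Y : {set V}, Y \proper X -> difference e Y < difference e X].
Proof.
case: hX => P [/set0Pn[S SP] minP ->].
have lt_d (Y : {set V}) : Y \proper cover P -> difference e Y < difference e (cover P).
  exact: difference_proper_cover.
split=> //.
- move=> u v uX vX; apply/negP=> euv.
  (* An edge from [u] to [v] inside the union makes the removal of [v] genuine. *)
  have /lt_d : cover P :\: neighbours e (cover P) \proper cover P.
    apply/properP; split; first exact: subsetDl.
    exists v => //; rewrite inE negb_and negbK; apply/orP; left.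
    by apply/neighboursP; exists u.
  by rewrite ltNge difference_setD_neighbours.
- rewrite -(difference0 V e); apply: lt_d; rewrite proper0.
  (* An empty union would force [S] to be empty, of difference zero. *)
  apply: contraTneq (min_positive_gt0 _ _ _ (minP S SP)) => P0.
  have : S \subset cover P by apply: bigcup_sup SP.
  by rewrite P0 subset0 => /eqP->; rewrite difference0.
Qed.
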